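(* There exists a centred weakly stationary sequence $X_1,X_2,\ldots$ with finite second moments such that $\operatorname{Var}(S_{2^r})/2^r$ converges (to a limit in $(0,\infty)$) as $r\to\infty$, but $\operatorname{Var}(S_n)/n$ does not converge as $n\to\infty$.
   Context: $S_n=X_1+\cdots+X_n$. *)

(* Defs.v *)
(* No measure theory is installed, so a
   probability space is encoded as a Daniell(-Stone) probability integral:
   a Stone vector lattice of functions with a positive, normalised linear
   functional E that is continuous along decreasing sequences.  By the
   Daniell-Stone theorem this is exactly an (integral w.r.t. a)
   probability measure on Omega. *)
From Stdlib Require Import Reals.
Open Scope R_scope.

Record ProbSpace := {
  Omega : Type;
  Lint : (Omega -> R) -> Prop;
  E : (Omega -> R) -> R;                (* expectation (meaningful on Lint) *)
  Lint_const : forall c : R, Lint (fun _ => c);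
  Lint_add : forall f g, Lint f -> Lint g -> Lint (fun w => f w + g w);
  Lint_scal : forall c f, Lint f -> Lint (fun w => c * f w);
  Lint_abs : forall f, Lint f -> Lint (fun w => Rabs (f w));
  Lint_min1 : forall f, Lint f -> Lint (fun w => Rmin (f w) 1);
  E_add : forall f g, Lint f -> Lint g -> E (fun w => f w + g w) = E f + E g;
  E_scal : forall c f, Lint f -> E (fun w => c * f w) = c * E f;
  E_pos : forall f, Lint f -> (forall w, 0 <= f w) -> 0 <= E f;
  E_one : E (fun _ => 1) = 1;
  E_daniell : forall fn : nat -> Omega -> R,
      (forall n, Lint (fn n)) ->
      (forall n w, fn (S n) w <= fn n w) ->
      (forall w, Un_cv (fun n => fn n w) 0) ->
      Un_cv (fun n => E (fn n)) 0
}.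

(* X n is the random variable X_{n+1} of the paper. *)
Definition second_moments (P : ProbSpace) (X : nat -> Omega P -> R) : Prop :=
  forall i j, Lint P (X i) /\ Lint P (fun w => X i w * X j w).

Definition centred (P : ProbSpace) (X : nat -> Omega P -> R) : Prop :=
  forall i, E P (X i) = 0.

Definition Cov (P : ProbSpace) (f g : Omega P -> R) : R :=
  E P (fun w => f w * g w) - E P f * E P g.

Definition Var (P : ProbSpace) (f : Omega P -> R) : R := Cov P f f.

Definition weakly_stationary (P : ProbSpace) (X : nat -> Omega P -> R) : Prop :=
  (forall i, E P (X i) = E P (X 0%nat)) /\
  (forall i j k, Cov P (X (i + k)%nat) (X (j + k)%nat) = Cov P (X i) (X j)).

(* partial sums: Ssum X n = X_1 + ... + X_n *)
Fixpoint Ssum {O : Type} (X : nat -> O -> R) (n : nat) : O -> R :=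
  match n with
  | O => fun _ => 0
  | S m => fun w => Ssum X m w + X m w
  end.

(* Main.v *)
Require Import Defs.
From Coquelicot Require Import Coquelicot.
From Stdlib Require Import Reals Lra Lia.
Import Defs.
Open Scope R_scope.

(* The process is a mixture over levels [j], chosen with probability [2^-(j+1)], of the
   square wave of half-period [2^j] with a uniformly random phase.  For one such wave,
   [Var S_n] depends only on [n] modulo the period [2^(j+1)], is invariant under
   [n |-> 2^(j+1) - n], and equals [n^2 - 2n(n^2-1)/(3 2^j)] for [n <= 2^j].  At [n = m 2^r]
   the levels [j < r] contribute nothing and the others sum to geometric series, giving
   [Var S_(2^r) / 2^r = 5/9 + 4/(9 4^r)] but [Var S_(3 2^r) / (3 2^r) = 11/18 + 1/(6 4^r)].
   The probability space is the Daniell integral on bounded functions of [(level, phase)];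
   monotone continuity holds because the levels beyond [N] carry mass [2^-(N+1)]. *)

Fixpoint rsum (f : nat -> R) (n : nat) : R :=
  match n with O => 0 | S m => rsum f m + f m end.

Lemma rsum_ext f g n :
  (forall i, (i < n)%nat -> f i = g i) -> rsum f n = rsum g n.
Proof.
  induction n as [|n IH]; intros Hfg; simpl; [reflexivity|].
  rewrite IH by (intros; apply Hfg; lia).
  rewrite Hfg by lia; reflexivity.
Qed.

Lemma rsum_plus f g n : rsum (fun i => f i + g i) n = rsum f n + rsum g n.
Proof. induction n as [|n IH]; simpl; [lra|]. rewrite IH; lra. Qed.

Lemma rsum_scal c f n : rsum (fun i => c * f i) n = c * rsum f n.
Proof. induction n as [|n IH]; simpl; [lra|]. rewrite IH; lra. Qed.

Lemma rsum_const c n : rsum (fun _ => c) n = INR n * c.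
Proof. induction n as [|n IH]; simpl rsum; [simpl; lra|]. rewrite IH, S_INR; lra. Qed.

Lemma rsum_eq_const f n c :
  (forall i, (i < n)%nat -> f i = c) -> rsum f n = INR n * c.
Proof. intros Hf; rewrite (rsum_ext f (fun _ => c)) by exact Hf; apply rsum_const. Qed.

Lemma rsum_le f g n : (forall i, f i <= g i) -> rsum f n <= rsum g n.
Proof. intros Hfg; induction n as [|n IH]; simpl; [lra|]. specialize (Hfg n); lra. Qed.

Lemma rsum_succ_l f n : rsum f (S n) = f O + rsum (fun i => f (S i)) n.
Proof. induction n as [|n IH]; simpl in *; [lra|]. rewrite IH; lra. Qed.

Lemma rsum_add f a b :
  rsum f (a + b) = rsum f a + rsum (fun i => f (a + i)%nat) b.
Proof.
  induction b as [|b IH]; simpl; [rewrite Nat.add_0_r; lra|].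
  rewrite Nat.add_succ_r; simpl; rewrite IH; lra.
Qed.

Lemma rsum_swap (F : nat -> nat -> R) n m :
  rsum (fun u => rsum (F u) n) m = rsum (fun i => rsum (fun u => F u i) m) n.
Proof.
  induction n as [|n IH]; simpl.
  - rewrite rsum_const; simpl; lra.
  - rewrite rsum_plus, IH; reflexivity.
Qed.

Lemma rsum_sum_f_R0 f n : rsum f (S n) = sum_f_R0 f n.
Proof. induction n as [|n IH]; [simpl; ring|]. cbn [rsum sum_f_R0] in *. rewrite <- IH; reflexivity. Qed.

Lemma rsum_periodic_shift (g : nat -> R) p k :
  (forall u, g (u + p)%nat = g u) -> rsum (fun u => g (u + k)%nat) p = rsum g p.
Proof.
  intros Hg; induction k as [|k IH].
  - apply rsum_ext; intros; rewrite Nat.add_0_r; reflexivity.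
  - rewrite <- IH.
    transitivity (rsum (fun i => g (S i + k)%nat) p).
    + apply rsum_ext; intros; f_equal; lia.
    + pose proof (rsum_succ_l (fun u => g (u + k)%nat) p) as Hsucc; simpl rsum in Hsucc.
      replace (p + k)%nat with (k + p)%nat in Hsucc by lia.
      rewrite Hg in Hsucc; simpl in *; lra.
Qed.

Definition square_wave (h v : nat) : R :=
  if Nat.ltb (v mod (2 * h)) h then 1 else -1.

Lemma square_wave_lt h v : (v < h)%nat -> square_wave h v = 1.
Proof.
  intros Hv; unfold square_wave; rewrite Nat.mod_small by lia.
  destruct (Nat.ltb_spec v h); [reflexivity|lia].
Qed.

Lemma square_wave_ge h v : (h <= v < 2 * h)%nat -> square_wave h v = -1.
Proof.
  intros Hv; unfold square_wave; rewrite Nat.mod_small by lia.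
  destruct (Nat.ltb_spec v h); [lia|reflexivity].
Qed.

Lemma square_wave_periodic h v : square_wave h (v + 2 * h) = square_wave h v.
Proof.
  unfold square_wave; replace (v + 2 * h)%nat with (v + 1 * (2 * h))%nat by lia.
  rewrite Nat.Div0.mod_add; reflexivity.
Qed.

Lemma square_wave_sqr h v : square_wave h v * square_wave h v = 1.
Proof. unfold square_wave; destruct Nat.ltb; lra. Qed.

Lemma square_wave_abs h v : Rabs (square_wave h v) = 1.
Proof. unfold square_wave, Rabs; destruct Nat.ltb, Rcase_abs; lra. Qed.

Lemma square_wave_period_sum h i : rsum (fun u => square_wave h (u + i)) (2 * h) = 0.
Proof.
  rewrite (rsum_periodic_shift (square_wave h)) by (intros; apply square_wave_periodic).
  replace (2 * h)%nat with (h + h)%nat by lia; rewrite rsum_add.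
  rewrite (rsum_eq_const _ h 1) by (intros; apply square_wave_lt; lia).
  rewrite (rsum_eq_const _ h (-1)) by (intros; apply square_wave_ge; lia).
  lra.
Qed.

(* Over one period the shifted wave agrees with the wave on [2(h-k)] places and disagrees on [2k]. *)
Lemma square_wave_autocorr h k : (k <= h)%nat ->
  rsum (fun u => square_wave h u * square_wave h (u + k)) (2 * h) = 2 * INR h - 4 * INR k.
Proof.
  intros Hk.
  replace (2 * h)%nat with ((h - k) + (k + ((h - k) + k)))%nat by lia.
  rewrite !rsum_add.
  rewrite (rsum_eq_const _ (h - k) 1)
    by (intros; rewrite !square_wave_lt by lia; lra).
  rewrite (rsum_eq_const _ k (-1))
    by (intros; rewrite square_wave_lt, square_wave_ge by lia; lra).
  rewrite (rsum_eq_const _ (h - k) 1)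
    by (intros; rewrite !square_wave_ge by lia; lra).
  rewrite (rsum_eq_const _ k (-1)).
  2: { intros i Hi; rewrite square_wave_ge by lia.
       replace (h - k + (k + (h - k + i)) + k)%nat with (i + 2 * h)%nat by lia.
       rewrite square_wave_periodic, square_wave_lt by lia; lra. }
  rewrite minus_INR by exact Hk; lra.
Qed.

Definition block_sum (h n u : nat) : R := rsum (fun i => square_wave h (u + i)) n.

Definition block_energy (h n : nat) : R :=
  rsum (fun u => block_sum h n u * block_sum h n u) (2 * h).

Lemma block_sum_periodic h n u : block_sum h n (u + 2 * h) = block_sum h n u.
Proof.
  apply rsum_ext; intros i _.
  rewrite <- (square_wave_periodic h (u + i)); f_equal; lia.
Qed.

Lemma block_sum_succ h n u : block_sum h (S n) u = square_wave h u + block_sum h n (S u).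
Proof.
  unfold block_sum; rewrite rsum_succ_l, Nat.add_0_r; f_equal.
  apply rsum_ext; intros; f_equal; lia.
Qed.

Lemma block_sum_add_period h n u : block_sum h (n + 2 * h) u = block_sum h n u.
Proof.
  unfold block_sum; rewrite rsum_add.
  rewrite (rsum_ext (fun i => square_wave h (u + (n + i))) (fun i => square_wave h (i + (u + n)))) by (intros; f_equal; lia).
  rewrite square_wave_period_sum; lra.
Qed.

(* A window of a full period sums to zero, so a window of length [n] is minus the complementary one. *)
Lemma block_sum_complement h n u : (n <= 2 * h)%nat ->
  block_sum h n (u + (2 * h - n)) = - block_sum h (2 * h - n) u.
Proof.
  intros Hn.
  pose proof (square_wave_period_sum h u) as Hzero.
  rewrite (rsum_ext _ (fun i => square_wave h (u + i))) in Hzero by (intros; f_equal; lia).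
  replace (2 * h)%nat with ((2 * h - n) + n)%nat in Hzero by lia.
  rewrite rsum_add in Hzero; unfold block_sum.
  rewrite (rsum_ext _ (fun i => square_wave h (u + (2 * h - n + i)))) by (intros; f_equal; lia).
  lra.
Qed.

(* Expanding [(square_wave h u + block_sum h n (u+1))^2]: the cross terms are the autocorrelations of lags [1..n]. *)
Lemma block_energy_succ h n : (n < h)%nat ->
  block_energy h (S n) =
  block_energy h n + 2 * (2 * INR h * INR n - 2 * INR n * (INR n + 1)) + 2 * INR h.
Proof.
  intros Hn; unfold block_energy.
  rewrite (rsum_ext _ (fun u => square_wave h u * square_wave h u
      + (2 * (square_wave h u * block_sum h n (S u))
         + block_sum h n (u + 1) * block_sum h n (u + 1))))
    by (intros; rewrite block_sum_succ, Nat.add_1_r; ring).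
  rewrite !rsum_plus, rsum_scal.
  rewrite (rsum_eq_const _ _ 1) by (intros; apply square_wave_sqr).
  rewrite (rsum_periodic_shift (fun u => block_sum h n u * block_sum h n u))
    by (intros; rewrite block_sum_periodic; reflexivity).
  assert (Hcross : rsum (fun u => square_wave h u * block_sum h n (S u)) (2 * h)
                   = rsum (fun i => 2 * INR h - 4 * INR (S i)) n).
  { rewrite (rsum_ext _ (fun u => rsum (fun i => square_wave h u * square_wave h (u + S i)) n)).
    2: { intros; unfold block_sum; rewrite <- rsum_scal.
         apply rsum_ext; intros; do 2 f_equal; lia. }
    rewrite rsum_swap; apply rsum_ext; intros; apply square_wave_autocorr; lia. }
  assert (Hlin : rsum (fun i => 2 * INR h - 4 * INR (S i)) n
                 = 2 * INR h * INR n - 2 * INR n * (INR n + 1)).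
  { clear Hn Hcross; induction n as [|n IH]; [simpl; lra|].
    cbn [rsum]; rewrite IH, !S_INR; lra. }
  rewrite Hcross, Hlin, mult_INR; simpl (INR 2); lra.
Qed.

Lemma block_energy_small h n : (n <= h)%nat ->
  block_energy h n = 2 * INR h * INR n ^ 2 - 4 * INR n * (INR n ^ 2 - 1) / 3.
Proof.
  induction n as [|n IH]; intros Hn.
  - unfold block_energy, block_sum; simpl; rewrite rsum_const; lra.
  - rewrite block_energy_succ, IH by lia; rewrite S_INR; field.
Qed.

Lemma block_energy_add_periods h n m : block_energy h (n + m * (2 * h)) = block_energy h n.
Proof.
  induction m as [|m IH]; [rewrite Nat.add_0_r; reflexivity|].
  rewrite <- IH; unfold block_energy; apply rsum_ext; intros.
  replace (n + S m * (2 * h))%nat with ((n + m * (2 * h)) + 2 * h)%nat by lia.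
  rewrite block_sum_add_period; reflexivity.
Qed.

Lemma block_energy_complement h n : (n <= 2 * h)%nat ->
  block_energy h n = block_energy h (2 * h - n).
Proof.
  intros Hn; unfold block_energy.
  rewrite <- (rsum_periodic_shift (fun u => block_sum h n u * block_sum h n u) (2 * h) (2 * h - n))
    by (intros; rewrite block_sum_periodic; reflexivity).
  apply rsum_ext; intros; rewrite block_sum_complement by exact Hn; ring.
Qed.

Definition bounded {T : Type} (f : T -> R) : Prop := exists M, forall w, Rabs (f w) <= M.

Lemma bounded_const {T : Type} (c : R) : bounded (fun _ : T => c).
Proof. exists (Rabs c); intros; lra. Qed.

Lemma bounded_plus {T : Type} (f g : T -> R) :
  bounded f -> bounded g -> bounded (fun w => f w + g w).
Proof.
  intros [M HM] [N HN]; exists (M + N); intros w.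
  eapply Rle_trans; [apply Rabs_triang|]; specialize (HM w); specialize (HN w); lra.
Qed.

Lemma bounded_scal {T : Type} (c : R) (f : T -> R) : bounded f -> bounded (fun w => c * f w).
Proof.
  intros [M HM]; exists (Rabs c * M); intros w; rewrite Rabs_mult.
  apply Rmult_le_compat_l; [apply Rabs_pos|apply HM].
Qed.

Lemma bounded_abs {T : Type} (f : T -> R) : bounded f -> bounded (fun w => Rabs (f w)).
Proof. intros [M HM]; exists M; intros w; rewrite Rabs_Rabsolu; apply HM. Qed.

Lemma bounded_min1 {T : Type} (f : T -> R) : bounded f -> bounded (fun w => Rmin (f w) 1).
Proof.
  intros [M HM]; exists (Rabs M + 1); intros w; specialize (HM w).
  apply Rabs_le_between in HM; pose proof (Rle_abs M); pose proof (Rabs_pos M).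
  apply Rabs_le; unfold Rmin; destruct Rle_dec; lra.
Qed.

Lemma is_series_geom_half (c : R) : is_series (fun j => c * (/ 2) ^ S j) c.
Proof.
  assert (Hgeom := is_series_scal_l (c / 2) _ _
                     (is_series_geom (/ 2) ltac:(rewrite Rabs_pos_eq; lra))).
  replace c with (scal (c / 2) (/ (1 - / 2))) by (unfold scal; simpl; unfold mult; simpl; field).
  eapply is_series_ext; [|exact Hgeom]; intros j.
  unfold scal; simpl; unfold mult; simpl; field.
Qed.

Lemma Series_zero : Series (fun _ => 0) = 0.
Proof.
  rewrite (Series_ext _ (fun n => 0 * (/ 2) ^ n)) by (intros; ring).
  rewrite Series_scal_l; ring.
Qed.

Lemma is_lim_seq_rsum (g : nat -> nat -> R) K :
  (forall i, (i < K)%nat -> is_lim_seq (fun n => g n i) 0) ->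
  is_lim_seq (fun n => rsum (g n) K) 0.
Proof.
  induction K as [|K IH]; intros Hg; simpl.
  - apply is_lim_seq_const.
  - replace (Finite 0) with (Finite (0 + 0)) by (f_equal; ring).
    apply is_lim_seq_plus'; [apply IH; intros; apply Hg; lia | apply Hg; lia].
Qed.

Section GeometricMixture.

Variable len : nat -> nat.
Hypothesis len_pos : forall j, (0 < len j)%nat.

Definition level_mean (j : nat) (f : nat * nat -> R) : R :=
  rsum (fun u => f (j, u)) (len j) / INR (len j).

Definition mixture_mean (f : nat * nat -> R) : R :=
  Series (fun j => (/ 2) ^ S j * level_mean j f).

Lemma INR_len_pos j : 0 < INR (len j).
Proof. apply lt_0_INR, len_pos. Qed.

Lemma level_mean_plus j f g :
  level_mean j (fun w => f w + g w) = level_mean j f + level_mean j g.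
Proof. unfold level_mean; rewrite rsum_plus; field; apply Rgt_not_eq, INR_len_pos. Qed.

Lemma level_mean_scal j c f : level_mean j (fun w => c * f w) = c * level_mean j f.
Proof. unfold level_mean; rewrite rsum_scal; field; apply Rgt_not_eq, INR_len_pos. Qed.

Lemma level_mean_const j c : level_mean j (fun _ => c) = c.
Proof. unfold level_mean; rewrite rsum_const; field; apply Rgt_not_eq, INR_len_pos. Qed.

Lemma level_mean_le j f g : (forall w, f w <= g w) -> level_mean j f <= level_mean j g.
Proof.
  intros Hfg; unfold level_mean; apply Rmult_le_compat_r.
  - left; apply Rinv_0_lt_compat, INR_len_pos.
  - apply rsum_le; intros; apply Hfg.
Qed.

Lemma level_mean_between j f a b :
  (forall w, a <= f w <= b) -> a <= level_mean j f <= b.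
Proof.
  intros Hf; rewrite <- (level_mean_const j a), <- (level_mean_const j b).
  split; apply level_mean_le; intros w; apply Hf.
Qed.

Lemma ex_series_mixture f : bounded f -> ex_series (fun j => (/ 2) ^ S j * level_mean j f).
Proof.
  intros [M HM].
  apply (@ex_series_le R_AbsRing R_CompleteNormedModule _ (fun j => M * (/ 2) ^ S j)).
  - intros j; change (norm ((/ 2) ^ S j * level_mean j f)) with (Rabs ((/ 2) ^ S j * level_mean j f)).
    rewrite Rabs_mult, Rabs_pos_eq by (apply pow_le; lra); rewrite Rmult_comm.
    apply Rmult_le_compat_r; [apply pow_le; lra|].
    apply Rabs_le, level_mean_between; intros w; apply Rabs_le_between, HM.
  - eexists; apply is_series_geom_half.
Qed.

Lemma mixture_mean_plus f g :
  bounded f -> bounded g -> mixture_mean (fun w => f w + g w) = mixture_mean f + mixture_mean g.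
Proof.
  intros Hf Hg; unfold mixture_mean.
  rewrite <- Series_plus by (apply ex_series_mixture; assumption).
  apply Series_ext; intros; rewrite level_mean_plus; ring.
Qed.

Lemma mixture_mean_scal c f : mixture_mean (fun w => c * f w) = c * mixture_mean f.
Proof.
  unfold mixture_mean; rewrite <- Series_scal_l.
  apply Series_ext; intros; rewrite level_mean_scal; ring.
Qed.

Lemma mixture_mean_nonneg f : bounded f -> (forall w, 0 <= f w) -> 0 <= mixture_mean f.
Proof.
  intros Hb Hf; unfold mixture_mean; rewrite <- Series_zero.
  apply Series_le; [|apply ex_series_mixture, Hb]; intros j; split; [lra|].
  apply Rmult_le_pos; [apply pow_le; lra|].
  rewrite <- (level_mean_const j 0); apply level_mean_le, Hf.
Qed.

Lemma mixture_mean_one : mixture_mean (fun _ => 1) = 1.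
Proof.
  unfold mixture_mean.
  rewrite (Series_ext _ (fun j => 1 * (/ 2) ^ S j)) by (intros; rewrite level_mean_const; ring).
  apply is_series_unique, is_series_geom_half.
Qed.

(* Levels beyond [N] carry total mass [2^-(N+1)]. *)
Lemma mixture_mean_le_head f M N :
  bounded f -> (forall w, 0 <= f w <= M) ->
  mixture_mean f <= rsum (fun j => (/ 2) ^ S j * level_mean j f) (S N) + M * (/ 2) ^ S N.
Proof.
  intros Hb Hf; unfold mixture_mean.
  rewrite (Series_incr_n _ (S N)) by (lia || apply ex_series_mixture, Hb).
  simpl pred; rewrite <- rsum_sum_f_R0; apply Rplus_le_compat_l.
  assert (Htail := is_series_geom_half (M * (/ 2) ^ S N)).
  rewrite <- (is_series_unique _ _ Htail).
  apply Series_le; [|eexists; exact Htail]; intros k.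
  replace (M * (/ 2) ^ S N * (/ 2) ^ S k) with ((/ 2) ^ S (S N + k) * M)
    by (replace (S (S N + k)) with (S N + S k)%nat by lia; rewrite pow_add; ring).
  split; [apply Rmult_le_pos; [apply pow_le; lra|]|apply Rmult_le_compat_l; [apply pow_le; lra|]];
    apply (level_mean_between _ _ 0 M), Hf.
Qed.

Lemma is_lim_seq_level_mean (fn : nat -> nat * nat -> R) j :
  (forall w, is_lim_seq (fun n => fn n w) 0) -> is_lim_seq (fun n => level_mean j (fn n)) 0.
Proof.
  intros Hcv; unfold level_mean.
  rewrite <- (Rmult_0_l (/ INR (len j))).
  apply (is_lim_seq_scal_r _ _ 0), is_lim_seq_rsum; intros; apply Hcv.
Qed.

Lemma mixture_mean_daniell (fn : nat -> nat * nat -> R) :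
  (forall n, bounded (fn n)) -> (forall n w, fn (S n) w <= fn n w) ->
  (forall w, Un_cv (fun n => fn n w) 0) -> Un_cv (fun n => mixture_mean (fn n)) 0.
Proof.
  intros Hb Hdec Hcv.
  assert (Hnonneg : forall n w, 0 <= fn n w)
    by (intros n w; apply (decreasing_ineq (fun n => fn n w)); [intros m; apply Hdec|apply Hcv]).
  destruct (Hb O) as [M0 HM0].
  assert (HM : forall n w, 0 <= fn n w <= Rabs M0).
  { intros n w; split; [apply Hnonneg|].
    assert (Hmono : fn n w <= fn O w).
    { induction n as [|n IH]; [lra|]; specialize (Hdec n w); lra. }
    specialize (HM0 w); apply Rabs_le_between in HM0; pose proof (Rle_abs M0); lra. }
  intros eps Heps.
  destruct (pow_lt_1_zero (/ 2) ltac:(rewrite Rabs_pos_eq; lra) (eps / (2 * (Rabs M0 + 1))))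
    as [N HN]; [apply Rdiv_lt_0_compat; pose proof (Rabs_pos M0); lra|].
  specialize (HN N (le_n N)); rewrite Rabs_pos_eq in HN by (apply pow_le; lra).
  assert (Htail : Rabs M0 * (/ 2) ^ S N < eps / 2).
  { pose proof (Rabs_pos M0); pose proof (pow_lt (/ 2) N ltac:(lra)).
    apply (Rmult_lt_compat_l (Rabs M0 + 1)) in HN; [|lra].
    replace ((Rabs M0 + 1) * (eps / (2 * (Rabs M0 + 1)))) with (eps / 2) in HN by (field; lra).
    simpl; nra. }
  assert (Hhead : is_lim_seq (fun n => rsum (fun j => (/ 2) ^ S j * level_mean j (fn n)) (S N)) 0).
  { apply is_lim_seq_rsum; intros j _.
    rewrite <- (Rmult_0_r ((/ 2) ^ S j)).
    apply (is_lim_seq_scal_l _ _ 0), is_lim_seq_level_mean.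
    intros w; apply is_lim_seq_Reals, Hcv. }
  apply is_lim_seq_Reals in Hhead.
  destruct (Hhead (eps / 2) ltac:(lra)) as [N2 HN2].
  exists N2; intros n Hn; specialize (HN2 n Hn); unfold R_dist in *; rewrite Rminus_0_r in *.
  pose proof (mixture_mean_le_head (fn n) (Rabs M0) N (Hb n) (HM n)).
  pose proof (mixture_mean_nonneg (fn n) (Hb n) (Hnonneg n)).
  apply Rabs_def2 in HN2; rewrite Rabs_pos_eq by assumption; lra.
Qed.

Definition mixture_space : ProbSpace := {|
  Omega := nat * nat; Lint := bounded; E := mixture_mean;
  Lint_const := bounded_const; Lint_add := bounded_plus; Lint_scal := bounded_scal;
  Lint_abs := bounded_abs; Lint_min1 := bounded_min1;
  E_add := mixture_mean_plus; E_scal := fun c f _ => mixture_mean_scal c f;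
  E_pos := mixture_mean_nonneg; E_one := mixture_mean_one;
  E_daniell := mixture_mean_daniell |}.

End GeometricMixture.

Definition phase_count (j : nat) : nat := 2 * 2 ^ j.

Lemma phase_count_pos j : (0 < phase_count j)%nat.
Proof. unfold phase_count; pose proof (Nat.pow_nonzero 2 j); lia. Qed.

Definition wave_space : ProbSpace := mixture_space phase_count phase_count_pos.

Definition wave (n : nat) (w : nat * nat) : R := square_wave (2 ^ fst w) (snd w + n).

Definition wave_variance (h n : nat) : R := block_energy h n / INR (2 * h).

Lemma wave_bounded i : bounded (wave i).
Proof. exists 1; intros; unfold wave; rewrite square_wave_abs; lra. Qed.

Lemma wave_mul_bounded i j : bounded (fun w => wave i w * wave j w).
Proof. exists 1; intros; unfold wave; rewrite Rabs_mult, !square_wave_abs; lra. Qed.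

Lemma Ssum_wave n j u : Ssum wave n (j, u) = block_sum (2 ^ j) n u.
Proof. induction n as [|n IH]; simpl; [reflexivity|]; rewrite IH; reflexivity. Qed.

Lemma mean_wave i : mixture_mean phase_count (wave i) = 0.
Proof.
  unfold mixture_mean; rewrite <- Series_zero; apply Series_ext; intros j.
  unfold level_mean, wave, phase_count; simpl; rewrite square_wave_period_sum; lra.
Qed.

Lemma mean_Ssum_wave n : mixture_mean phase_count (Ssum wave n) = 0.
Proof.
  unfold mixture_mean; rewrite <- Series_zero; apply Series_ext; intros j.
  unfold level_mean, phase_count.
  rewrite (rsum_ext _ (block_sum (2 ^ j) n)) by (intros; apply Ssum_wave).
  unfold block_sum; rewrite rsum_swap.
  rewrite (rsum_eq_const _ _ 0) by (intros; apply square_wave_period_sum); lra.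
Qed.

Lemma mean_wave_mul_shift a b k :
  mixture_mean phase_count (fun w => wave (a + k) w * wave (b + k) w)
  = mixture_mean phase_count (fun w => wave a w * wave b w).
Proof.
  unfold mixture_mean; apply Series_ext; intros j; f_equal.
  unfold level_mean, wave, phase_count; cbn [fst snd]; f_equal.
  rewrite <- (rsum_periodic_shift
               (fun u => square_wave (2 ^ j) (u + a) * square_wave (2 ^ j) (u + b)) _ k).
  - apply rsum_ext; intros; do 2 f_equal; lia.
  - intros u; rewrite <- (square_wave_periodic _ (u + a)), <- (square_wave_periodic _ (u + b)).
    do 2 f_equal; lia.
Qed.

Lemma Var_Ssum_wave n :
  Var wave_space (Ssum wave n) = Series (fun j => (/ 2) ^ S j * wave_variance (2 ^ j) n).
Proof.
  unfold Var, Cov; simpl; rewrite mean_Ssum_wave, Rmult_0_l, Rminus_0_r.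
  apply Series_ext; intros j; f_equal.
  unfold level_mean, wave_variance, phase_count, block_energy; f_equal.
  apply rsum_ext; intros; rewrite Ssum_wave; reflexivity.
Qed.

Lemma wave_variance_small h n : (0 < h)%nat -> (n <= h)%nat ->
  wave_variance h n = INR n ^ 2 - 2 * INR n * (INR n ^ 2 - 1) / (3 * INR h).
Proof.
  intros Hh Hn; unfold wave_variance; rewrite block_energy_small, mult_INR by exact Hn.
  assert (0 < INR h) by (apply lt_0_INR, Hh); simpl (INR 2); field; lra.
Qed.

Lemma wave_variance_add_periods h n m : wave_variance h (n + m * (2 * h)) = wave_variance h n.
Proof. unfold wave_variance; rewrite block_energy_add_periods; reflexivity. Qed.

Lemma wave_variance_complement h n : (n <= 2 * h)%nat ->
  wave_variance h n = wave_variance h (2 * h - n).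
Proof. intros Hn; unfold wave_variance; rewrite block_energy_complement by exact Hn; reflexivity. Qed.

Lemma wave_variance_multiple h m : wave_variance h (m * (2 * h)) = 0.
Proof.
  rewrite <- (Nat.add_0_l (m * (2 * h))), wave_variance_add_periods.
  unfold wave_variance, block_energy, block_sum; simpl.
  rewrite rsum_const; unfold Rdiv; ring.
Qed.

(* Levels [j < r] see a whole number of periods in a block of length [m 2^r]. *)
Lemma Var_Ssum_wave_from_level r m :
  Var wave_space (Ssum wave (m * 2 ^ r)) =
  Series (fun k => (/ 2) ^ S (r + k) * wave_variance (2 ^ (r + k)) (m * 2 ^ r)).
Proof.
  rewrite Var_Ssum_wave, (Series_incr_n_aux _ r); [reflexivity|]; intros j Hj.
  replace (m * 2 ^ r)%nat with ((m * 2 ^ (r - j - 1)) * (2 * 2 ^ j))%nat.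
  - rewrite wave_variance_multiple; ring.
  - replace r with ((r - j - 1) + S j)%nat at 2 by lia; rewrite Nat.pow_add_r, Nat.pow_succ_r'; ring.
Qed.

Lemma is_series_geom_pair A B :
  is_series (fun k => A * (/ 2) ^ k + B * ((/ 2) ^ k * (/ 2) ^ k)) (2 * A + 4 / 3 * B).
Proof.
  assert (HA := is_series_scal_l A _ _ (is_series_geom (/ 2) ltac:(rewrite Rabs_pos_eq; lra))).
  assert (HB := is_series_scal_l B _ _ (is_series_geom (/ 4) ltac:(rewrite Rabs_pos_eq; lra))).
  replace (2 * A + 4 / 3 * B) with (plus (scal A (/ (1 - / 2))) (scal B (/ (1 - / 4))))
    by (unfold plus, scal; simpl; unfold mult; simpl; field).
  eapply is_series_ext; [|exact (is_series_plus _ _ _ _ HA HB)]; intros k.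
  unfold plus, scal; simpl; unfold mult; simpl.
  rewrite <- Rpow_mult_distr; replace (/ 2 * / 2) with (/ 4) by field; reflexivity.
Qed.

Lemma pow2_pos k : 0 < 2 ^ k.
Proof. apply pow_lt; lra. Qed.

Lemma pow2_nat_pos k : (0 < 2 ^ k)%nat.
Proof. pose proof (Nat.pow_nonzero 2 k); lia. Qed.

Lemma INR_pow2 k : INR (2 ^ k) = 2 ^ k.
Proof. rewrite pow_INR; reflexivity. Qed.

Lemma dyadic_variance_ratio r :
  Var wave_space (Ssum wave (2 ^ r)) / INR (2 ^ r) = 5 / 9 + 4 / 9 * (/ 4) ^ r.
Proof.
  pose proof (pow2_pos r) as Hr.
  assert (Hvar : Var wave_space (Ssum wave (2 ^ r))
                 = (/ 2) ^ S r * (2 * (2 ^ r) ^ 2 - 8 / 9 * ((2 ^ r) ^ 2 - 1))).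
  { rewrite <- (Nat.mul_1_l (2 ^ r)), Var_Ssum_wave_from_level, Nat.mul_1_l.
    apply is_series_unique.
    replace ((/ 2) ^ S r * (2 * (2 ^ r) ^ 2 - 8 / 9 * ((2 ^ r) ^ 2 - 1)))
      with (2 * ((/ 2) ^ S r * (2 ^ r) ^ 2)
            + 4 / 3 * (- ((/ 2) ^ S r * (2 / 3) * ((2 ^ r) ^ 2 - 1)))) by field.
    eapply is_series_ext; [|apply is_series_geom_pair]; intros k.
    rewrite wave_variance_small by (apply pow2_nat_pos || (apply Nat.pow_le_mono_r; lia)).
    pose proof (pow2_pos k).
    rewrite !INR_pow2, !pow_inv; simpl; rewrite pow_add; field; lra. }
  replace (/ 4) with (/ 2 * / 2) by field.
  rewrite Hvar, INR_pow2, Rpow_mult_distr, !pow_inv; simpl; field; lra.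
Qed.

Lemma triple_variance_ratio r :
  11 / 18 <= Var wave_space (Ssum wave (3 * 2 ^ r)) / INR (3 * 2 ^ r).
Proof.
  pose proof (pow2_pos r) as Hr.
  assert (Hlevel_r : wave_variance (2 ^ r) (3 * 2 ^ r) = wave_variance (2 ^ r) (2 ^ r)).
  { replace (3 * 2 ^ r)%nat with (2 ^ r + 1 * (2 * 2 ^ r))%nat by lia.
    apply wave_variance_add_periods. }
  assert (Hlevel_Sr : wave_variance (2 ^ S r) (3 * 2 ^ r) = wave_variance (2 ^ S r) (2 ^ r)).
  { rewrite wave_variance_complement by (rewrite Nat.pow_succ_r'; lia).
    f_equal; rewrite Nat.pow_succ_r'; lia. }
  assert (Hvar : Var wave_space (Ssum wave (3 * 2 ^ r)) =
                 (/ 2) ^ S r * ((2 ^ r) ^ 2 - 2 * ((2 ^ r) ^ 2 - 1) / 3)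
                 + (/ 2) ^ S (S r) * ((2 ^ r) ^ 2 - ((2 ^ r) ^ 2 - 1) / 3)
                 + (/ 2) ^ S (S (S r)) * (18 * (2 ^ r) ^ 2 - 2 / 3 * (9 * (2 ^ r) ^ 2 - 1))).
  { rewrite Var_Ssum_wave_from_level.
    apply is_series_unique, is_series_decr_1, is_series_decr_1.
    rewrite Nat.add_0_r, Nat.add_1_r, Hlevel_r, Hlevel_Sr.
    rewrite !wave_variance_small by (apply pow2_nat_pos || (rewrite ?Nat.pow_succ_r'; lia)).
    rewrite Nat.pow_succ_r', mult_INR, !INR_pow2.
    match goal with |- is_series _ ?V =>
      replace V with (2 * ((/ 2) ^ S (S (S r)) * (9 * (2 ^ r) ^ 2))
                      + 4 / 3 * (- ((/ 2) ^ S (S (S r)) * ((9 * (2 ^ r) ^ 2 - 1) / 2))))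
        by (unfold plus, opp; simpl; field; lra) end.
    eapply is_series_ext; [|apply is_series_geom_pair]; intros k.
    rewrite wave_variance_small.
    2: apply pow2_nat_pos.
    2: { rewrite Nat.pow_add_r; simpl; pose proof (pow2_nat_pos k); nia. }
    pose proof (pow2_pos k).
    rewrite mult_INR, !INR_pow2, !pow_inv; simpl; rewrite !pow_add; simpl; field; lra. }
  rewrite Hvar, mult_INR, INR_pow2, !pow_inv; simpl.
  match goal with |- _ <= ?V => replace V with (11 / 18 + / (6 * (2 ^ r * 2 ^ r))) by (field; lra) end.
  assert (0 < / (6 * (2 ^ r * 2 ^ r))) by (apply Rinv_0_lt_compat; nra).
  lra.
Qed.

Lemma dyadic_variance_ratio_lim :
  is_lim_seq (fun r => Var wave_space (Ssum wave (2 ^ r)) / INR (2 ^ r)) (5 / 9).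
Proof.
  eapply is_lim_seq_ext; [intros r; symmetry; apply dyadic_variance_ratio|].
  replace (Finite (5 / 9)) with (Finite (5 / 9 + 4 / 9 * 0)) by (f_equal; ring).
  apply is_lim_seq_plus'; [apply is_lim_seq_const|].
  apply (is_lim_seq_scal_l _ _ 0), is_lim_seq_geom; rewrite Rabs_pos_eq; lra.
Qed.

Lemma not_ex_lim_of_subseqs (u : nat -> R) (phi psi : nat -> nat) (a b : R) :
  (forall n, (phi n < phi (S n))%nat) -> (forall n, (psi n < psi (S n))%nat) ->
  is_lim_seq (fun n => u (phi n)) a -> (forall n, b <= u (psi n)) -> a < b ->
  ~ exists l, Un_cv u l.
Proof.
  intros Hphi Hpsi Ha Hb Hab [l Hl]; apply is_lim_seq_Reals in Hl.
  assert (Hal : Finite a = Finite l).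
  { rewrite <- (is_lim_seq_unique _ _ Ha).
    apply is_lim_seq_unique, is_lim_seq_subseq; [apply eventually_subseq, Hphi|exact Hl]. }
  assert (Hbl : Rbar_le b l).
  { apply (is_lim_seq_le (fun _ => b) (fun n => u (psi n))); [exact Hb|apply is_lim_seq_const|].
    apply is_lim_seq_subseq; [apply eventually_subseq, Hpsi|exact Hl]. }
  injection Hal as ->; simpl in Hbl; lra.
Qed.

Theorem proposition2 :
  exists (P : ProbSpace) (X : nat -> Omega P -> R),
    centred P X /\ weakly_stationary P X /\ second_moments P X /\
    (exists l : R, 0 < l /\
       Un_cv (fun r => Var P (Ssum X (2 ^ r)) / INR (2 ^ r)) l) /\
    ~ (exists l : R, Un_cv (fun n => Var P (Ssum X n) / INR n) l).
Proof.
  exists wave_space, wave; split; [|split; [|split; [|split]]].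
  - intros i; apply mean_wave.
  - split; intros; unfold Cov; simpl; rewrite ?mean_wave, ?mean_wave_mul_shift; reflexivity.
  - intros i j; split; [apply wave_bounded|apply wave_mul_bounded].
  - exists (5 / 9); split; [lra|]; apply is_lim_seq_Reals, dyadic_variance_ratio_lim.
  - apply (not_ex_lim_of_subseqs _ (fun r => 2 ^ r)%nat (fun r => 3 * 2 ^ r)%nat (5 / 9) (11 / 18)).
    + intros r; rewrite Nat.pow_succ_r'; pose proof (pow2_nat_pos r); lia.
    + intros r; rewrite Nat.pow_succ_r'; pose proof (pow2_nat_pos r); lia.
    + exact dyadic_variance_ratio_lim.
    + exact triple_variance_ratio.
    + lra.
Qed.
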